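(* Let $x\in\mathbb{R}^{n}$, $u\in U$, $\delta\in(0,1)$, and $\delta^{(i)}\in(0,1)$ for $i\in[n_P]$, with $\sum_{i\in[n_P]}\delta^{(i)}\le\delta$. If for each $i\in[n_P]$ there exists $j\in[m_i]$ such that $$c_{ij}^\top f(x,u)-\tilde b_{ij}(x)\ \ge\ -\,q_{\delta^{(i)}}\big(c_{ij}^\top g(x,\xi)\big),$$ then $$\mathbb{P}_\xi\{h(F(x,u,\xi))<\alpha h(x)\}\le\delta .$$
   Context: For $k\in\mathbb{N}$, $[k]=\{1,\dots,k\}$. The dynamics are $F(x,u,\xi)=f(x,u)+g(x,\xi)$ with values in $\mathbb{R}^n$, where $x\in\mathbb{R}^{n}$, $u\in U\subseteq\mathbb{R}^{m}$ ($U$ nonempty, closed, convex), and $\xi$ is an $\mathbb{R}^{n_\xi}$-valued random variable with law $\mathbb{P}_\xi$ (all maps are measurable in $\xi$). The constant $\alpha\in[0,1]$ is fixed. The function $h:\mathbb{R}^n\to\mathbb{R}$ is piecewise affine of the form $$h(x)=\min_{i\in[n_P]}h_i(x),\qquad h_i(x)=\max_{j\in[m_i]}\big(c_{ij}^\top x-b_{ij}\big),$$ with $n_P,m_i\ge 1$ integers, $c_{ij}\in\mathbb{R}^n$, $b_{ij}\in\mathbb{R}$. Define $\tilde b_{ij}(x)=b_{ij}+\alpha h(x)$ if the sign convention is such that $h_i(F(x,u,\xi))\ge\alpha h(x)$ if and only if $c_{ij}^\top F(x,u,\xi)\ge\tilde b_{ij}(x)$ for some $j\in[m_i]$; this is the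 convention used here, i.e. $\tilde b_{ij}(x):=b_{ij}+\alpha h(x)$. For a real random variable $Z$ and $\delta\in(0,1)$, $q_\delta(Z)=\inf\{\tau\in\mathbb{R}:\mathbb{P}\{Z\le\tau\}\ge\delta\}$ is the $\delta$-quantile of $Z$; in $q_{\delta^{(i)}}(c_{ij}^\top g(x,\xi))$ the state $x$ is fixed and $\xi\sim\mathbb{P}_\xi$. *)

(* Defs.v *)
From HB Require Import structures.
From mathcomp Require Import all_boot all_order all_algebra.
From mathcomp Require Import all_classical all_reals all_analysis.

Set Implicit Arguments.
Unset Strict Implicit.
Unset Printing Implicit Defensive.

Import Order.TTheory GRing.Theory Num.Theory.
Import numFieldNormedType.Exports.

Local Open Scope classical_set_scope.
Local Open Scope ring_scope.

(* R^n with its Borel sigma-algebra, i.e. the one generated by the open sets of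
   the matrix topology; as a type it is convertible to 'cV[R]_n. *)
Notation borel_cV R n := (g_sigma_algebraType (@open 'cV[R]_n)).

Definition dotp (R : realType) (n : nat) (c v : 'cV[R]_n) : R :=
  (c^T *m v) ord0 ord0.

(* Meant for Z measurable and 0 < delta < 1, in which case the set is nonempty
   and bounded below, so that the infimum in R is the genuine one. *)
Definition quantile (R : realType) (d : measure_display) (T : measurableType d)
    (P : probability T R) (delta : R) (Z : T -> R) : R :=
  inf [set tau : R | (delta%:E <= P [set t | (Z t <= tau)%R])%E].

Definition dynamics (R : realType) (n m nxi : nat)
    (f : 'cV[R]_n -> 'cV[R]_m -> 'cV[R]_n)
    (g : 'cV[R]_n -> 'cV[R]_nxi -> 'cV[R]_n)
    (x : 'cV[R]_n) (u : 'cV[R]_m) (z : 'cV[R]_nxi) : 'cV[R]_n :=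
  f x u + g x z.

(* There are nP.+1 >= 1 pieces, the i-th having (k i).+1 >= 1 affine maps. The
   initial value of each iterated min and max is one of the values iterated
   over, so it does not affect the result. *)
Definition pwa_piece (R : realType) (n nP : nat) (k : 'I_nP.+1 -> nat)
    (c : forall i : 'I_nP.+1, 'I_(k i).+1 -> 'cV[R]_n)
    (b : forall i : 'I_nP.+1, 'I_(k i).+1 -> R)
    (i : 'I_nP.+1) (x : 'cV[R]_n) : R :=
  \big[Num.max/dotp (c i ord0) x - b i ord0]_(j < (k i).+1)
    (dotp (c i j) x - b i j).

Definition pwa (R : realType) (n nP : nat) (k : 'I_nP.+1 -> nat)
    (c : forall i : 'I_nP.+1, 'I_(k i).+1 -> 'cV[R]_n)
    (b : forall i : 'I_nP.+1, 'I_(k i).+1 -> R) (x : 'cV[R]_n) : R :=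
  \big[Num.min/pwa_piece c b ord0 x]_(i < nP.+1) pwa_piece c b i x.

Definition shifted_offset (R : realType) (n nP : nat) (k : 'I_nP.+1 -> nat)
    (alpha : R) (c : forall i : 'I_nP.+1, 'I_(k i).+1 -> 'cV[R]_n)
    (b : forall i : 'I_nP.+1, 'I_(k i).+1 -> R)
    (i : 'I_nP.+1) (j : 'I_(k i).+1) (x : 'cV[R]_n) : R :=
  b i j + alpha * pwa c b x.

(* Main.v *)
(* If h (F (x, u, z)) < alpha h x, then some piece h_i, and hence each of its affine
   maps, is below alpha h x at F (x, u, z). For the index j chosen in the hypothesis
   this forces c_ij^T g (x, z) to be strictly below its quantile of level
   delta^(i), an event of probability at most delta^(i); the union bound over i
   concludes. *)
Require Import Defs.
From mathcomp Require Import lra.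
From HB Require Import structures.
From mathcomp Require Import all_boot all_order all_algebra.
From mathcomp Require Import all_classical all_reals all_analysis.
From mathcomp Require Import measurable_realfun.

Set Implicit Arguments.
Unset Strict Implicit.
Unset Printing Implicit Defensive.

Import Order.TTheory GRing.Theory Num.Theory.
Import numFieldNormedType.Exports.

Local Open Scope classical_set_scope.
Local Open Scope ring_scope.

(** Coordinates are continuous, so they pull open intervals back to open sets, which generate the
    sigma-algebra of [borel_cV]; [dotp c] is a linear combination of coordinates. *)
Lemma measurable_dotp (R : realType) (n : nat) (c : 'cV[R]_n) :
  measurable_fun [set: borel_cV R n] (dotp c : borel_cV R n -> R).
Proof.
have mcoord i : measurable_fun [set: borel_cV R n]
    ((fun v : 'cV[R]_n => v i ord0) : borel_cV R n -> R).
  apply: (measurability _ (RGenOpens.measurableE R)).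
  move=> _ [_ [a [b ->]] <-]; rewrite setTI; apply: sub_sigma_algebra.
  apply: open_comp; last exact: interval_open.
  by move=> v _; exact: coord_continuous.
have -> : dotp c = fun v => \sum_(i < n) c i ord0 * v i ord0.
  by apply/funext => v; rewrite /dotp mxE; apply: eq_bigr => i _; rewrite mxE.
by apply: measurable_sum => i; exact: measurable_funM.
Qed.

(** The initial value varies with [t] because that of [pwa_piece] depends on the point. *)
Lemma measurable_bigmax d (T : measurableType d) (R : realType) (I : Type)
    (s : seq I) (f0 : T -> R) (f : I -> T -> R) :
  measurable_fun setT f0 -> (forall i, measurable_fun setT (f i)) ->
  measurable_fun setT (fun t => \big[Num.max/f0 t]_(i <- s) f i t).
Proof.
move=> mf0 mf; elim: s => [|i s IHs].
  by under eq_fun do rewrite big_nil.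
by under eq_fun do rewrite big_cons; exact: measurable_maxr.
Qed.

Lemma measurable_bigmin d (T : measurableType d) (R : realType) (I : Type)
    (s : seq I) (f0 : T -> R) (f : I -> T -> R) :
  measurable_fun setT f0 -> (forall i, measurable_fun setT (f i)) ->
  measurable_fun setT (fun t => \big[Num.min/f0 t]_(i <- s) f i t).
Proof.
move=> mf0 mf; elim: s => [|i s IHs].
  by under eq_fun do rewrite big_nil.
by under eq_fun do rewrite big_cons; exact: measurable_minr.
Qed.

Lemma dotpD (R : realType) (n : nat) (c v w : 'cV[R]_n) :
  dotp c (v + w) = dotp c v + dotp c w.
Proof. by rewrite /dotp mulmxDr mxE. Qed.

Lemma measurable_lt_cst d (T : measurableType d) (R : realType) (Z : T -> R)
    (r : R) : measurable_fun setT Z -> measurable [set t | Z t < r].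
Proof.
move=> mZ; rewrite -[X in measurable X]setTI.
rewrite (_ : [set t | _] = Z @^-1` `]-oo, r[); first exact: mZ.
by apply/seteqP; split => t; rewrite /= in_itv.
Qed.

Lemma measurable_le_cst d (T : measurableType d) (R : realType) (Z : T -> R)
    (r : R) : measurable_fun setT Z -> measurable [set t | Z t <= r].
Proof.
move=> mZ; rewrite -[X in measurable X]setTI.
rewrite (_ : [set t | _] = Z @^-1` `]-oo, r]); first exact: mZ.
by apply/seteqP; split => t; rewrite /= in_itv.
Qed.

(* An infimum in R of a set unbounded below would be the junk value 0. *)
Lemma has_lbound_quantile_set d (T : measurableType d) (R : realType)
    (P : probability T R) (delta : R) (Z : T -> R) :
  measurable_fun setT Z -> 0 < delta ->
  has_lbound [set tau : R | (delta%:E <= P [set t | (Z t <= tau)%R])%E].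
Proof.
move=> mZ delta_gt0.
pose X : {RV P >-> R} := HB.pack Z (isMeasurableFun.Build _ _ _ _ Z mZ).
have cdfXE r : cdf X r = P [set t | Z t <= r] by [].
(* The cdf tends to 0 at [-oo], hence is below [delta] to the left of some [M], which is then a
   lower bound. *)
have [M [_ ltM]] : \forall r \near -oo, (cdf X r < delta%:E)%E.
  apply: (@cvg_cdfNy0 _ _ _ P X [set y | (y < delta%:E)%E]).
  by apply: open_nbhs_nbhs; split; [exact: open_ereal_lt_ereal|rewrite /= lte_fin].
exists M => tau /=; rewrite -cdfXE; apply: contra_leT.
by rewrite -ltNge; exact: ltM.
Qed.

(* Below the quantile q every P {Z <= tau} is less than delta, and {Z < q} is the
   increasing union of the sets {Z <= q - 1/(n+1)}; P {Z <= q} may exceed delta. *)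
Lemma prob_lt_quantile d (T : measurableType d) (R : realType)
    (P : probability T R) (delta : R) (Z : T -> R) :
  measurable_fun setT Z -> 0 < delta ->
  (P [set t | (Z t < quantile P delta Z)%R] <= delta%:E)%E.
Proof.
move=> mZ delta_gt0; set q := quantile P delta Z.
pose F n := [set t | Z t <= q - n.+1%:R^-1].
have mF n : measurable (F n) by exact: measurable_le_cst.
have -> : [set t | Z t < q] = \bigcup_n F n.
  apply/seteqP; split => t /=.
    move=> /ltr_add_invr [n ltq]; exists n => //=.
    by rewrite /F /= lerBrDr ltW.
  by move=> [n _] /le_lt_trans; apply; rewrite ltrBlDr ltrDl invr_gt0.
have PF n : (P (F n) <= delta%:E)%E.
  (* Otherwise [q - n.+1%:R^-1] would lie in the set whose infimum is [q]. *)
  rewrite leNgt; apply/negP => /ltW.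
  move=> /(ge_inf (has_lbound_quantile_set P mZ delta_gt0)).
  by apply/negP; rewrite -ltNge ltrBlDr ltrDl invr_gt0.
have ndF : nondecreasing_seq F.
  move=> a b ab; apply/subsetPset => t /= /le_trans; apply.
  by rewrite lerD2l lerN2 lef_pV2 ?posrE// ler_nat.
(* Continuity from below carries the bound on each [P (F n)] to the union. *)
apply: (cvge_to_le (nondecreasing_cvg_mu mF (bigcupT_measurable _ mF) ndF)).
by apply: nearW => n; exact: PF.
Qed.

(** The union bound: monotonicity of [mu], then subadditivity for two sets by induction on [s]. *)
Lemma measure_le_sum d (T : measurableType d) (R : realType)
    (mu : {measure set T -> \bar R}) (I : Type) (s : seq I) (A : I -> set T)
    (a : I -> R) (B : set T) :
  measurable B -> (forall i, measurable (A i)) ->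
  (forall i, (mu (A i) <= (a i)%:E)%E) ->
  B `<=` \big[setU/set0]_(i <- s) A i ->
  (mu B <= (\sum_(i <- s) a i)%:E)%E.
Proof.
move=> mB mA muA subB.
have mU : measurable (\big[setU/set0]_(i <- s) A i).
  by apply: big_ind => //; exact: measurableU.
apply: (le_trans (le_measure mu _ _ subB)); rewrite ?inE//.
elim: s {mB subB mU} => [|i s IHs]; first by rewrite !big_nil measure0.
rewrite !big_cons EFinD; apply: le_trans (leeD (muA i) IHs).
by apply: measureU2 => //; apply: big_ind => //; exact: measurableU.
Qed.

Theorem proposition2 (R : realType) (n m nxi : nat)
    (U : set 'cV[R]_m) (U_neq0 : U !=set0) (U_closed : closed U)
    (U_convex : convex_set U)
    (f : 'cV[R]_n -> 'cV[R]_m -> 'cV[R]_n)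
    (g : 'cV[R]_n -> 'cV[R]_nxi -> 'cV[R]_n)
    (g_meas : forall x : 'cV[R]_n,
       measurable_fun [set: borel_cV R nxi]
         (g x : borel_cV R nxi -> borel_cV R n))
    (d : measure_display) (Omega : measurableType d) (P : probability Omega R)
    (xi : {RV P >-> borel_cV R nxi})
    (alpha : R) (alpha01 : 0 <= alpha <= 1)
    (nP : nat) (k : 'I_nP.+1 -> nat)
    (c : forall i : 'I_nP.+1, 'I_(k i).+1 -> 'cV[R]_n)
    (b : forall i : 'I_nP.+1, 'I_(k i).+1 -> R)
    (x : 'cV[R]_n) (u : 'cV[R]_m) (Uu : U u)
    (delta : R) (delta01 : 0 < delta < 1)
    (deltas : 'I_nP.+1 -> R) (deltas01 : forall i, 0 < deltas i < 1)
    (sum_deltas : \sum_(i < nP.+1) deltas i <= delta) :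
  (forall i : 'I_nP.+1, exists j : 'I_(k i).+1,
     dotp (c i j) (f x u) - shifted_offset alpha c b j x >=
     - quantile (distribution P xi) (deltas i)
         (fun z => dotp (c i j) (g x z))) ->
  (distribution P xi
     [set z | (pwa c b (dynamics f g x u z) < alpha * pwa c b x)%R]
   <= delta%:E)%E.
Proof.
(* One index per piece is fixed before any [z], so that the events of the union bound are determined
   by [i] alone. *)
move=> /fin_all_exists[j hj].
pose Z i j : borel_cV R nxi -> R := fun z => dotp (c i j) (g x z).
have mZ i l : measurable_fun setT (Z i l).
  exact: (measurableT_comp (measurable_dotp (c i l)) (g_meas x)).
have mpwa : measurable_fun setT
    ((fun z => pwa c b (dynamics f g x u z)) : borel_cV R nxi -> R).
  have maff i l : measurable_fun setT
      ((fun z => dotp (c i l) (dynamics f g x u z) - b i l) :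
        borel_cV R nxi -> R).
    under eq_fun do rewrite dotpD.
    apply: measurable_funB; last exact: measurable_cst.
    by apply: measurable_funD; [exact: measurable_cst|exact: mZ].
  by apply: measurable_bigmin => [|i]; apply: measurable_bigmax.
pose q i := quantile (distribution P xi) (deltas i) (Z i (j i)).
have sum_le : ((\sum_(i < nP.+1) deltas i)%:E <= delta%:E)%E.
  by rewrite lee_fin.
apply: (le_trans _ sum_le).
apply: (measure_le_sum (A := fun i => [set z | Z i (j i) z < q i])).
- exact: measurable_lt_cst.
- by move=> i; exact: measurable_lt_cst.
- by move=> i; apply: prob_lt_quantile => //; case/andP: (deltas01 i).
- move=> z /= ltz.
  have [i lti] : exists i,
      pwa_piece c b i (dynamics f g x u z) < alpha * pwa c b x.
    apply: contrapT => /forallNP nlt.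
    have piece_ge i : alpha * pwa c b x <= pwa_piece c b i (dynamics f g x u z).
      by rewrite leNgt; apply/negP/nlt.
    (* The initial value of the minimum is itself a piece, so [piece_ge] bounds it as well. *)
    by move: ltz; apply/negP; rewrite -leNgt; apply/bigmin_geP.
  rewrite -bigcup_seq; exists i; first exact: mem_index_enum.
  have /= := le_lt_trans (le_bigmax _ _ (j i)) lti.
  rewrite /dynamics dotpD => affine_lt.
  have := hj i; rewrite /shifted_offset -/(q i) => hji.
  (* With h the function [pwa c b], adding c^T f - b - alpha h(x) >= -q to c^T f + c^T g - b < alpha
     h(x) leaves c^T g < q. *)
  by rewrite /Z /=; lra.
Qed.
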